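(* Every topological space with property ${\sf S}_1(\Omega,\Omega)$ has property ${\sf Q}(\Omega,\Omega)$.
   Context: ''Cover'' means countable open cover. For a space $X$, a cover $\mathcal{U}$ of $X$ is an $\omega$-cover if $X\notin\mathcal{U}$ and every finite subset of $X$ is contained in some member of $\mathcal{U}$. $X$ has ${\sf S}_1(\Omega,\Omega)$ if for every sequence $(\mathcal{U}_n)$ of $\omega$-covers of $X$ one can choose $U_n\in\mathcal{U}_n$ with $\{U_n:n\in\omega\}$ an $\omega$-cover of $X$. $X$ has ${\sf Q}(\Omega,\Omega)$ if for every $\omega$-cover $\mathcal{U}$ of $X$ and every partition of $\mathcal{U}$ into countably many pairwise disjoint nonempty finite sets $\mathcal{F}_0,\mathcal{F}_1,\mathcal{F}_2,\dots$, there is $\mathcal{V}\subseteq\mathcal{U}$ which is an $\omega$-cover of $X$ with $|\mathcal{V}\cap\mathcal{F}_n|\le 1$ for each $n$. *)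

(* Defs.v *)
From mathcomp Require Import all_boot.
From mathcomp Require Import boolp classical_sets functions cardinality topology.

Set Implicit Arguments.
Unset Strict Implicit.
Unset Printing Implicit Defensive.

Local Open Scope classical_set_scope.
Local Open Scope card_scope.

Definition countable_open_cover (X : topologicalType) (U : set (set X)) : Prop :=
  [/\ countable U, U `<=` [set A | open A] & \bigcup_(A in U) A = setT].

Definition omega_cover (X : topologicalType) (U : set (set X)) : Prop :=
  [/\ countable_open_cover U,
      ~ U setT
    & forall F : set X, finite_set F -> exists2 A, U A & F `<=` A].

Definition selection_S1 (X : Type) (P R : set (set (set X))) : Prop :=
  forall U : nat -> set (set X), (forall n, P (U n)) ->
    exists2 V : nat -> set X, (forall n, U n (V n)) & R (range V).

(* The partition is indexed by all of nat: an omega-cover is never finite, so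
   it has no partition into finitely many finite blocks. *)
Definition selection_Q (X : Type) (P R : set (set (set X))) : Prop :=
  forall U : set (set X), P U ->
  forall F : nat -> set (set X),
    partition setT F U -> (forall n, finite_set (F n)) ->
    exists V : set (set X),
      [/\ V `<=` U, R V & forall n, V `&` F n #<= `I_1].

(* Main.v *)
Require Import Defs.
From mathcomp Require Import all_boot.
From mathcomp Require Import boolp classical_sets functions cardinality topology.

(** Instead of applying S_1 to copies of the omega-cover U itself, apply it to
the families U_n of intersections of n + 1 members of U taken from pairwise
distinct blocks.  Each U_n is an omega-cover, because any finite set is
contained in members of infinitely many of the (finite) blocks.  Among the
n + 1 factors of the n-th selected intersection, at least one lies in a block
not used at the n earlier stages; enlarging the intersection to that factor
preserves the omega-covering property. *)

Set Implicit Arguments.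
Unset Strict Implicit.
Unset Printing Implicit Defensive.

Local Open Scope classical_set_scope.
Local Open Scope card_scope.

(** Greedy choice: at stage [n] only [n] values are taken, too few to exhaust the more than [n]
    distinct entries of [u n]. *)
Lemma injective_choice_seq (T : eqType) (u : nat -> seq T) :
  (forall n, uniq (u n)) -> (forall n, n < size (u n)) ->
  exists2 g : nat -> T, injective g & forall n, g n \in u n.
Proof.
move=> uniq_u size_u.
have fresh n (l : seq T) : exists x, size l = n -> x \in u n /\ x \notin l.
  have [sub_ul|] := boolP (all [in l] (u n)); last first.
    by case/allPn=> x xu xl; exists x.
  case uE: (u n) (size_u n) => [//|x s] _; exists x => size_l.
  have := uniq_leq_size (uniq_u n) (allP sub_ul).
  by rewrite size_l leqNgt size_u.
have [next nextP] := choice (fun p : nat * seq T => fresh p.1 p.2).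
(* [l n] lists the values chosen at the stages before [n], latest first. *)
pose l := fix l n := if n is m.+1 then next (m, l m) :: l m else [::].
have size_l n : size (l n) = n by elim: n => //= n ->.
pose g n := next (n, l n).
have gP n : g n \in u n /\ g n \notin l n by exact: (nextP (n, l n) (size_l n)).
have g_in m n : m < n -> g m \in l n.
  elim: n => //= n IHn; rewrite ltnS leq_eqVlt inE => /predU1P[-> | /IHn ->].
    by rewrite eqxx.
  by rewrite orbT.
exists g => [m n gmn | n]; last by case: (gP n).
case: (ltngtP m n) => // [/g_in | /g_in].
  by rewrite gmn (negPf (gP n).2).
by rewrite -gmn (negPf (gP m).2).
Qed.

Lemma omega_cover_intro (X : topologicalType) (U : set (set X)) :
  countable U -> U `<=` [set A | open A] -> ~ U setT ->
  (forall S : set X, finite_set S -> exists2 A, U A & S `<=` A) ->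
  omega_cover U.
Proof.
move=> cU oU UT fU; split=> //; split=> //.
apply/seteqP; split=> // x _.
by have [A UA /(_ x erefl) Ax] := fU _ (finite_set1 x); exists A.
Qed.

(** Add to [S] a point outside each proper subset in [G]: no member of [U] containing this larger
    finite set can lie in [G]. *)
Lemma omega_cover_avoid (X : topologicalType) (U G : set (set X)) (S : set X) :
  omega_cover U -> finite_set G -> finite_set S ->
  exists A, [/\ U A, S `<=` A & ~ G A].
Proof.
move=> [_ UT fU] finG finS.
have /choice[E EP] (B : set X) :
    exists E, finite_set E /\ (B <> setT -> ~ E `<=` B).
  have [BT|/existsNP[x Bx]] := pselect (forall x, B x).
    by exists set0; split=> // nBT; case: nBT; apply/seteqP; split.
  by exists [set x]; split=> [|_ /(_ x erefl)]; [exact: finite_set1|].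
have finS' : finite_set (S `|` \bigcup_(B in G) E B).
  by rewrite finite_setU; split=> //; apply: bigcup_finite => // B _; case: (EP B).
have [A UA] := fU _ finS'; rewrite subUset => -[SA EA].
exists A; split=> // GA; apply: (EP A).2 => [|x Ex]; last by apply: EA; exists A.
by move=> AT; apply: UT; rewrite -AT.
Qed.

(** The map [c] names the block of a set, so [uniq] puts the factors in distinct blocks. *)
Definition block_meets (X : Type) (I : eqType) (c : set X -> I)
    (U : set (set X)) (n : nat) : set (set X) :=
  [set W | exists s : seq (set X),
    [/\ [set` s] `<=` U, size s = n.+1, uniq [seq c A | A <- s]
      & W = \bigcap_(A in [set` s]) A]].

Lemma omega_cover_block_meets (X : topologicalType) (I : eqType)
    (c : set X -> I) (U : set (set X)) (n : nat) :
  omega_cover U -> (forall i, finite_set [set A | U A /\ c A = i]) ->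
  omega_cover (block_meets c U n).
Proof.
move=> omU fin_c; have [[cU oU _] UT _] := omU; apply: omega_cover_intro.
(* The family lies in the image, under intersection, of the finite subsets of [U]. *)
- apply: (sub_countable _ (countable_finite_subset cU)).
  apply: (card_le_trans _
    (card_image_le (fun G => \bigcap_(A in G) A) _)).
  apply: subset_card_le => W [s [sU _ _ ->]].
  by exists [set` s] => //; split=> //; exact: finite_seq.
- move=> W [s [sU _ _ ->]] /=; rewrite bigcap_seq big_seq.
  by apply: big_ind => [|A B|A /sU/oU //]; [exact: openT|exact: openI].
- move=> [[|A s] [sU //= _ _ WT]].
  apply: UT; suff <- : A = setT by apply: sU; rewrite /= mem_head.
  by apply/seteqP; split=> // x; rewrite WT; apply; rewrite /= mem_head.
- move=> S finS.
  suff [s [sU size_s uniq_s sS]] : exists s : seq (set X),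
      [/\ [set` s] `<=` U, size s = n.+1, uniq [seq c A | A <- s]
        & forall A, A \in s -> S `<=` A].
    exists (\bigcap_(A in [set` s]) A); first by exists s.
    by move=> x Sx A /sS; apply.
  elim: n.+1 => [|m [s [sU size_s uniq_s sS]]]; first by exists [::].
  (* All members of [U] in blocks already used; a member avoiding [G] extends [s] by a new block. *)
  pose G := \bigcup_(i in [set` [seq c A | A <- s]]) [set A | U A /\ c A = i].
  have finG : finite_set G.
    by apply: bigcup_finite => [|i _]; [exact: finite_seq|exact: fin_c].
  have [A [UA SA GA]] := omega_cover_avoid omU finG finS.
  exists (A :: s); split=> /=.
  + by move=> B /=; rewrite inE => /predU1P[-> //|/sU].
  + by rewrite size_s.
  + by rewrite uniq_s andbT; apply/negP => cA; apply: GA; exists (c A).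
  + by move=> B; rewrite inE => /predU1P[-> //|/sS].
Qed.

Theorem mainTheorem10 (X : topologicalType) :
  selection_S1 (@omega_cover X) (@omega_cover X) ->
  selection_Q (@omega_cover X) (@omega_cover X).
Proof.
move=> S1 U omU F [FU trivF _] finF.
have [[_ oU _] UT _] := omU.
have FsubU n A : F n A -> U A by move=> FA; rewrite -FU; exists n.
(* [c A] is the index of the block of [A], meaningful only for [A] in [U]. *)
have /choice[c cP] (A : set X) : exists n, U A -> F n A.
  have [UA|nUA] := pselect (U A); last by exists 0.
  by move: (UA); rewrite -FU => -[n _ FA]; exists n.
have cE n A : F n A -> c A = n.
  by move=> FA; apply: trivF => //; exists A; split=> //; apply/cP/FsubU/FA.
have fin_c n : finite_set [set A | U A /\ c A = n].
  by apply: sub_finite_set (finF n) => A [/cP FA <-].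
have [W WU [_ _ fW]] := S1 _ (fun n => omega_cover_block_meets n omU fin_c).
have [s sP] := choice WU.
(* The greedy choice runs on block indices, so the factors [V n] picked below lie in pairwise
   distinct blocks. *)
have [n|n|g g_inj gs] := @injective_choice_seq _ (fun n => [seq c A | A <- s n]).
- by case: (sP n).
- by case: (sP n) => _ size_s _ _; rewrite size_map size_s.
have /choice[V VP] n : exists A, A \in s n /\ g n = c A.
  by have /mapP[A As gE] := gs n; exists A.
have VU n : U (V n) by case: (sP n) => sU _ _ _; apply: sU; case: (VP n).
exists (range V); split.
- by move=> _ [n _ <-].
- apply: omega_cover_intro.
  + exact: card_le_trans (card_image_le _ _) (countableP _).
  + by move=> _ [n _ <-]; exact: oU.
  + by move=> [n _ VT]; apply: UT; rewrite -VT.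
  (* [V n] is a factor of the intersection [W n], hence contains it. *)
  + move=> S /fW[_ [n _ <-] SW]; exists (V n); first by exists n.
    apply: subset_trans SW _; case: (sP n) => _ _ _ -> x; apply.
    by case: (VP n).
- move=> n; have [->|/set0P[_ [[m _ <-] FVm]]] := eqVneq (range V `&` F n) set0.
    exact: card_ge0.
  (* Once [V m] lies in the block, any [V k] there has [g k = g m], so [k = m]. *)
  rewrite -(card_le_eqr (card_set1 (x := V m))).
  apply: subset_card_le => _ [[k _ <-] FVk] /=; congr V.
  by apply: g_inj; rewrite (VP k).2 (VP m).2 (cE _ _ FVk) (cE _ _ FVm).
Qed.
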